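(* Let $X$ and $Y$ be $T_0$ spaces. If the function space $[X,Y]$ is a $d^{*}$-space, then $Y$ is a $d^{*}$-space.
   Context: $[X,Y]$ denotes the set $TOP(X,Y)$ of all continuous functions from $X$ to $Y$ endowed with the Isbell topology, i.e. the topology generated by the sets $N(H\leftarrow V)=\{f\in TOP(X,Y)\mid f^{-1}(V)\in H\}$, where $H$ ranges over the Scott open subsets of the complete lattice $\mathcal{O}(X)$ of open subsets of $X$ (ordered by inclusion) and $V$ ranges over the open subsets of $Y$. A subset $H$ of a poset is Scott open if it is an upper set and for every directed subset $D$ whose supremum exists, $\sup D\in H$ implies $D\cap H\neq\varnothing$; directed means nonempty and every finite subset has an upper bound in the set. For a $T_0$ space $Z$, the specialization order is $x\leq y$ iff $x\in\overline{\{y\}}$, and ${\uparrow}x=\{y\in Z\mid x\leq y\}$. A $T_0$ space $Z$ is a $d^{*}$-space if for every directed subset $D$ of $Z$ (in the specialization order), every $x\in Z$ and every nonempty open set $U\subseteq Z$, $\bigcap_{d\in D}{\uparrow}d\cap{\uparrow}x\subseteq U$ implies ${\uparrow}d\cap{\uparrow}x\subseteq U$ for some $d\in D$.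
   Formalization: The space X is additionally assumed nonempty: for empty X the function space [X,Y] is a single point, hence a d*-space, while Y may be any T0 space, for example the natural numbers with the upper-set topology plus an isolated point, which is not a d*-space. *)

(* Defs.v *)
From HB Require Import structures.
From mathcomp Require Import all_boot all_order.
From mathcomp Require Import boolp classical_sets functions cardinality.
From mathcomp Require Import topology.

Set Implicit Arguments.
Unset Strict Implicit.
Unset Printing Implicit Defensive.

Import Order.TTheory.

Local Open Scope classical_set_scope.

(* Parameterized by a relation, so as to serve both for the order of a
   porderType and for the specialization order of a space. *)
Definition directed (T : Type) (R : T -> T -> Prop) (D : set T) : Prop :=
  D !=set0 /\
  forall F : set T, finite_set F -> F `<=` D ->
    exists2 u, D u & forall x, F x -> R x u.

Definition scott_open (d : Order.disp_t) (T : porderType d) (H : set T) : Prop :=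
  (forall x y : T, (x <= y)%O -> H x -> H y) /\
  (forall (D : set T) (s : T), directed (fun x y => (x <= y)%O) D ->
    supremums D s -> H s -> D `&` H !=set0).

Definition opens (X : topologicalType) : Type := set_type (@open X).

HB.instance Definition _ (X : topologicalType) := SubChoice.on (opens X).
(* The order is the one of [set X], i.e., inclusion. *)
HB.instance Definition _ (X : topologicalType) :=
  [SubChoice_isSubPOrder of opens X by <: with set_display].

(* An alias, because the library already puts another topology on
   [continuousType X Y]. *)
Definition isbell (X Y : topologicalType) : Type := continuousType X Y.

HB.instance Definition _ (X Y : topologicalType) := Choice.on (isbell X Y).

(* For open [V] this is the set of those [f] with [f^-1(V)] in [H]: the image
   under [val] only turns the elements of [H] into subsets of [X]. *)
Definition isbell_subbase (X Y : topologicalType)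
    (H : set (opens X)) (V : set Y) : set (isbell X Y) :=
  [set f : continuousType X Y | (val @` H) (f @^-1` V)].

HB.instance Definition _ (X Y : topologicalType) :=
  @isSubBaseTopological.Build (isbell X Y)
    (set (opens X) * set Y)%type
    [set HV | scott_open HV.1 /\ open HV.2]
    (fun HV => isbell_subbase HV.1 HV.2).

Definition specialization (Z : topologicalType) (x y : Z) : Prop :=
  closure [set y] x.

Definition upset (Z : topologicalType) (x : Z) : set Z :=
  [set y | specialization x y].

Definition dstar_space (Z : topologicalType) : Prop :=
  kolmogorov_space Z /\
  forall (D : set Z) (x : Z) (U : set Z),
    directed (@specialization Z) D -> open U -> U !=set0 ->
    (\bigcap_(d in D) upset d) `&` upset x `<=` U ->
    exists2 d, D d & upset d `&` upset x `<=` U.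

(* Main.v *)
Require Import Defs.
From mathcomp Require Import all_boot all_order.
From mathcomp Require Import boolp classical_sets functions cardinality.
From mathcomp Require Import topology.
From mathcomp Require Import filter.

Local Open Scope classical_set_scope.

(** [Y] is a retract of [[X, Y]]: embed it by the constant maps and retract by
    evaluation at a point of [X]. Continuous maps preserve the specialization
    order, so the condition defining d*-spaces passes to retracts. *)

Lemma specialization_continuous (S T : topologicalType) (f : S -> T)
    (x y : S) :
  continuous f -> specialization x y -> specialization (f x) (f y).
Proof.
move=> cf xy A Afx.
have [_ [/= -> Afy]] := xy (f @^-1` A) (cf x A Afx).
by exists (f y).
Qed.

(** Apply the condition of [S] to the image of [D] and of [x] under [i] and to the preimage of [U]
    under [r]. Since [r] undoes [i], upper bounds move back and forth between the two spaces. *)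
Lemma dstar_retract (S T : topologicalType) (i : T -> S) (r : S -> T) :
  continuous i -> continuous r -> cancel i r -> kolmogorov_space T ->
  dstar_space S -> dstar_space T.
Proof.
move=> ci cr iK T0 [_ dS]; split=> // D x U [[d0 Dd0] dirD] oU [u Uu] DxU.
have [||||_ [d Dd <-] dxU] := dS (i @` D) (i x) (r @^-1` U).
- split; first by exists (i d0), d0.
  move=> F finF FD.
  (* [r] carries [F] back to a finite subset of [D]; the image under [i] of an upper bound of it
     bounds [F]. *)
  have [|_ [s /FD[d Dd <-] <-]|e De Fe] := dirD (r @` F).
  + exact: finite_image.
  + by rewrite iK.
  + exists (i e); first by exists e.
    move=> s Fs; have [d Dd ds] := FD s Fs; rewrite -ds.
    apply: specialization_continuous => //.
    by apply: Fe; exists s; rewrite // -ds iK.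
- exact: open_comp.
- by exists (i u); rewrite /= iK.
- move=> s [Ds xs]; apply: DxU; split=> [d Dd|].
  + rewrite /upset /= -[d]iK; apply: specialization_continuous (Ds _ _).
      exact: cr.
    by exists d.
  + by rewrite /upset /= -[x]iK; apply: specialization_continuous xs.
- exists d => // y [dy xy]; rewrite -[y]iK; apply: dxU.
  by split; apply: specialization_continuous.
Qed.

Lemma open_isbell_subbase (X Y : topologicalType) (H : set (opens X))
    (V : set Y) :
  scott_open H -> open V -> open (@isbell_subbase X Y H V).
Proof.
move=> sH oV; exists [set @isbell_subbase X Y H V]; last by rewrite bigcup_set1.
move=> _ ->.
exact: (@finI_from1 _ _ _ (fun HV => isbell_subbase HV.1 HV.2) (H, V)).
Qed.

(** Preimages commute with unions and intersections, so subbasic open sets suffice. *)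
Lemma continuous_isbell (X Y Z : topologicalType) (g : Z -> isbell X Y) :
  (forall H V, scott_open H -> open V -> open (g @^-1` isbell_subbase H V)) ->
  continuous g.
Proof.
move=> og; apply/continuousP => _ [B sB <-].
rewrite preimage_bigcup; apply: bigcup_open => A /sB[E sE <-].
(* A finite intersection is treated pointwise: the neighbourhoods of [z] form a filter. *)
rewrite preimage_bigcap openE => z Ez; apply: filter_bigI => HV EHV.
have /set_mem[sH oV] := sE _ EHV.
by apply: open_nbhs_nbhs; split; [exact: og|exact: Ez].
Qed.

Definition Opens {X : topologicalType} {W : set X} (oW : open W) : opens X :=
  exist _ W (mem_set oW).

Lemma scott_open_nbhs (X : topologicalType) (x : X) :
  scott_open [set W : opens X | (val W) x].
Proof.
split=> [A B AB Ax | D s _ [ubs lubs] sx].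
  by move: AB => /subsetPset; exact.
have oU : open (\bigcup_(W in D) (val W : set X)).
  by apply: bigcup_open => W _; exact: set_mem (valP W).
pose U : opens X := Opens oU.
have /lubs/subsetPset sU : ubound D U.
  by move=> W DW; apply/subsetPset => y Wy; exists W.
by have [W DW Wx] := sU x sx; exists W.
Qed.

Lemma continuous_isbell_eval (X Y : topologicalType) (x : X) :
  continuous (fun f : isbell X Y => (f : continuousType X Y) x).
Proof.
apply/continuousP => V oV.
rewrite [X in open X](_ : _ = isbell_subbase [set W : opens X | (val W) x] V).
  exact: open_isbell_subbase (scott_open_nbhs _ _) oV.
apply/seteqP; split=> [f fx|f [W Wx eW]].
  have oW : open ((f : continuousType X Y) @^-1` V).
    by apply: open_comp oV => y _; exact: (@cts_fun X Y f).
  by exists (Opens oW).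
by rewrite /= -[V _]/((_ @^-1` V) x) -eW.
Qed.

Lemma continuous_isbell_cst (X Y : topologicalType) :
  continuous (fun y : Y => (cst y : continuousType X Y) : isbell X Y).
Proof.
apply: continuous_isbell => H V [upH _] oV.
(* A constant map pulls [V] back to [set0] or [setT], so the preimage of
   [N(H <- V)] is [setT], [V] or [set0], depending on which of the two are in
   [H]. *)
have [H0|nH0] := pselect (exists2 W, H W & val W = set0).
  rewrite [X in open X](_ : _ = setT); first exact: openT.
  apply/seteqP; split=> // y _.
  have oW : open ((cst y : X -> Y) @^-1` V).
    by apply: open_comp oV => z _; exact: cst_continuous.
  have [W HW W0] := H0; exists (Opens oW) => //.
  (* The empty set lies below every open set, so [H] contains all of them. *)
  by apply: upH HW; apply/subsetPset; rewrite W0.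
have [HT|nHT] := pselect (exists2 W, H W & val W = setT).
  rewrite [X in open X](_ : _ = V) //.
  apply/seteqP; split=> y /=.
    by rewrite /isbell_subbase /= preimage_cst; case: ifPn => [/set_mem|_ /nH0].
  by move=> Vy; rewrite /isbell_subbase /= preimage_cst mem_set.
rewrite [X in open X](_ : _ = set0); first exact: open0.
rewrite -subset0 => y; rewrite /= /isbell_subbase /= preimage_cst.
by case: ifPn => _; [exact: nHT|exact: nH0].
Qed.

Theorem corollary3p19 (X Y : topologicalType) (X_neq0 : [set: X] !=set0)
    (X_T0 : kolmogorov_space X) (Y_T0 : kolmogorov_space Y) :
  dstar_space (isbell X Y) -> dstar_space Y.
Proof.
have [x0 _] := X_neq0.
exact: dstar_retract (@continuous_isbell_cst X Y)
  (@continuous_isbell_eval X Y x0) (fun=> erefl) Y_T0.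
Qed.
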